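(* Let $2\le n<\infty$, let $R=R_1\times R_2\times\cdots\times R_n$ where each $R_i$ is a commutative ring with identity, and let $M=M_1\times M_2\times\cdots\times M_n$ be the $R$-module where, for every $1\le i\le n$, $M_i$ is an $R_i$-module. Then for a proper submodule $N$ of $M$ the following conditions are equivalent: (a) $N$ is a strongly 2-irreducible submodule of $M$; (b) either $N=\prod_{i=1}^nN_i$ such that for some $k\in\{1,\dots,n\}$, $N_k$ is a strongly 2-irreducible submodule of $M_k$ and $N_i=M_i$ for every $i\in\{1,\dots,n\}\setminus\{k\}$; or $N=\prod_{i=1}^nN_i$ such that for some $k,m\in\{1,\dots,n\}$, $N_k$ is a strongly irreducible submodule of $M_k$, $N_m$ is a strongly irreducible submodule of $M_m$, and $N_i=M_i$ for every $i\in\{1,\dots,n\}\setminus\{k,m\}$.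
   Context: The ring $R$ acts on $M$ componentwise; each submodule of $M$ is of the form $\prod_{i=1}^n N_i$ with $N_i$ a submodule of $M_i$. A proper submodule $N$ of a module $M$ is strongly irreducible if whenever $H_1\cap H_2\subseteq N$ for submodules $H_1,H_2$ of $M$, then $H_1\subseteq N$ or $H_2\subseteq N$. A proper submodule $N$ of $M$ is strongly 2-irreducible if whenever $H_1\cap H_2\cap H_3\subseteq N$ for submodules $H_1,H_2,H_3$ of $M$, then $H_1\cap H_2\subseteq N$ or $H_2\cap H_3\subseteq N$ or $H_1\cap H_3\subseteq N$. *)

(* Defs.v *)
From HB Require Import structures.
From mathcomp Require Import all_boot all_algebra.
From mathcomp Require Import classical_sets.

Set Implicit Arguments.
Unset Strict Implicit.
Unset Printing Implicit Defensive.

Import GRing.Theory.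
Local Open Scope ring_scope.
Local Open Scope classical_set_scope.

Section ProductRing.
Variables (I : finType) (R : I -> comPzRingType).

Definition prod_ring : Type := {dffun forall i : I, R i}.

HB.instance Definition _ := Choice.on prod_ring.

Implicit Types a b c : prod_ring.

Definition pr_zero : prod_ring := [ffun i => 0 : R i].
Definition pr_opp a : prod_ring := [ffun i => - a i].
Definition pr_add a b : prod_ring := [ffun i => a i + b i].
Definition pr_one : prod_ring := [ffun i => 1 : R i].
Definition pr_mul a b : prod_ring := [ffun i => a i * b i].

Fact pr_addA : associative pr_add.
Proof. by move=> a b c; apply/ffunP => i; rewrite !ffunE addrA. Qed.
Fact pr_addC : commutative pr_add.
Proof. by move=> a b; apply/ffunP => i; rewrite !ffunE addrC. Qed.
Fact pr_add0 : left_id pr_zero pr_add.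
Proof. by move=> a; apply/ffunP => i; rewrite !ffunE add0r. Qed.
Fact pr_addN : left_inverse pr_zero pr_opp pr_add.
Proof. by move=> a; apply/ffunP => i; rewrite !ffunE addNr. Qed.

HB.instance Definition _ :=
  GRing.isZmodule.Build prod_ring pr_addA pr_addC pr_add0 pr_addN.

Fact pr_mulA : associative pr_mul.
Proof. by move=> a b c; apply/ffunP => i; rewrite !ffunE mulrA. Qed.
Fact pr_mulC : commutative pr_mul.
Proof. by move=> a b; apply/ffunP => i; rewrite !ffunE mulrC. Qed.
Fact pr_mul1 : left_id pr_one pr_mul.
Proof. by move=> a; apply/ffunP => i; rewrite !ffunE mul1r. Qed.
Fact pr_mulDl : left_distributive pr_mul pr_add.
Proof. by move=> a b c; apply/ffunP => i; rewrite !ffunE mulrDl. Qed.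

HB.instance Definition _ :=
  GRing.Zmodule_isComPzRing.Build prod_ring pr_mulA pr_mulC pr_mul1 pr_mulDl.

End ProductRing.

Section ProductModule.
Variables (I : finType) (R : I -> comPzRingType) (M : forall i, lmodType (R i)).

Definition prod_module : Type := {dffun forall i : I, M i}.

HB.instance Definition _ := Choice.on prod_module.

Implicit Types (a b : prod_ring R) (x y z : prod_module).

Definition pm_zero : prod_module := [ffun i => 0 : M i].
Definition pm_opp x : prod_module := [ffun i => - x i].
Definition pm_add x y : prod_module := [ffun i => x i + y i].
Definition pm_scale a x : prod_module := [ffun i => a i *: x i].

Fact pm_addA : associative pm_add.
Proof. by move=> x y z; apply/ffunP => i; rewrite !ffunE addrA. Qed.
Fact pm_addC : commutative pm_add.
Proof. by move=> x y; apply/ffunP => i; rewrite !ffunE addrC. Qed.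
Fact pm_add0 : left_id pm_zero pm_add.
Proof. by move=> x; apply/ffunP => i; rewrite !ffunE add0r. Qed.
Fact pm_addN : left_inverse pm_zero pm_opp pm_add.
Proof. by move=> x; apply/ffunP => i; rewrite !ffunE addNr. Qed.

HB.instance Definition _ :=
  GRing.isZmodule.Build prod_module pm_addA pm_addC pm_add0 pm_addN.

Fact pm_scaleA a b x : pm_scale a (pm_scale b x) = pm_scale (a * b) x.
Proof. by apply/ffunP => i; rewrite !ffunE scalerA. Qed.
Fact pm_scale1 : left_id 1 pm_scale.
Proof. by move=> x; apply/ffunP => i; rewrite !ffunE scale1r. Qed.
Fact pm_scaleDr : right_distributive pm_scale +%R.
Proof. by move=> a x y; apply/ffunP => i; rewrite !ffunE scalerDr. Qed.
Fact pm_scaleDl x : {morph pm_scale^~ x : a b / a + b}.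
Proof. by move=> a b; apply/ffunP => i; rewrite !ffunE scalerDl. Qed.

HB.instance Definition _ := GRing.Zmodule_isLmodule.Build (prod_ring R)
  prod_module pm_scaleA pm_scale1 pm_scaleDr pm_scaleDl.

Definition prod_set (N : forall i, set (M i)) : set prod_module :=
  [set x : prod_module | forall i, N i (x i)].

End ProductModule.

Section StronglyIrreducible.
Variables (R : comPzRingType) (M : lmodType R).

(* Subsets are arbitrary, Prop-valued; [GRing.submod_closed] sees them through
   the classical membership predicate of [set]. *)
Definition submodule (N : set M) : Prop := GRing.submod_closed [in N].

Definition proper_submodule (N : set M) : Prop := submodule N /\ N <> setT.

Definition strongly_irreducible (N : set M) : Prop :=
  proper_submodule N /\
  forall H1 H2 : set M, submodule H1 -> submodule H2 ->
    H1 `&` H2 `<=` N -> H1 `<=` N \/ H2 `<=` N.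

Definition strongly_2_irreducible (N : set M) : Prop :=
  proper_submodule N /\
  forall H1 H2 H3 : set M, submodule H1 -> submodule H2 -> submodule H3 ->
    H1 `&` H2 `&` H3 `<=` N ->
    [\/ H1 `&` H2 `<=` N, H2 `&` H3 `<=` N | H1 `&` H3 `<=` N].

End StronglyIrreducible.

(* Main.v *)
(** Idempotents of [R] split every submodule of the product into its components,
    so an inclusion of an intersection into a product can be tested componentwise.
    If a strongly 2-irreducible product had three proper components [N_a], [N_b],
    [N_c], it would be the intersection of the three submodules that drop two of
    these three constraints, while any two of them still drop one constraint.
    If exactly [N_k] and [N_m] are proper, intersecting two cylinders over [M_k]
    with the cylinder over [N_m] reduces strong 2-irreducibility of [N] to strong
    irreducibility of [N_k]. *)
Require Import Defs.
From mathcomp Require Import all_boot all_algebra.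
From mathcomp Require Import boolp classical_sets.

Local Open Scope classical_set_scope.

Import GRing.Theory.
Local Open Scope ring_scope.

(** * Closure properties of submodules given as sets *)

Section Submodules.
Set Implicit Arguments.
Unset Strict Implicit.
Variables (R : comPzRingType) (M : lmodType R).
Implicit Types N H : set M.

Lemma submoduleP N :
  submodule N <-> N 0 /\ forall a u v, N u -> N v -> N (a *: u + v).
Proof.
split=> -[N0 Nlin]; split.
- by move: N0; rewrite in_setE.
- move=> a u v Nu Nv; have := Nlin a u v.
  by rewrite !in_setE; apply.
- by rewrite in_setE.
- by move=> a u v; rewrite !in_setE; apply: Nlin.
Qed.

Lemma submodule0 N : submodule N -> N 0.
Proof. by case/submoduleP. Qed.

Lemma submoduleD N u v : submodule N -> N u -> N v -> N (u + v).
Proof. by case/submoduleP=> _ Nlin Nu Nv; rewrite -[u]scale1r; apply: Nlin. Qed.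

Lemma submoduleZ N a u : submodule N -> N u -> N (a *: u).
Proof. by case/submoduleP=> N0 Nlin Nu; rewrite -[_ *: _]addr0; apply: Nlin. Qed.

Lemma submoduleT : submodule [set: M].
Proof. exact/submoduleP. Qed.

Lemma submoduleI H1 H2 : submodule H1 -> submodule H2 -> submodule (H1 `&` H2).
Proof.
move=> /submoduleP[H10 H1lin] /submoduleP[H20 H2lin]; apply/submoduleP.
by split=> // a u v [? ?] [? ?]; split; [apply: H1lin | apply: H2lin].
Qed.

(** Two applications of the binary condition, the first to [H1]&[H2] against [H3]. *)
Lemma strongly_irreducible3 N H1 H2 H3 : strongly_irreducible N ->
  submodule H1 -> submodule H2 -> submodule H3 ->
  H1 `&` H2 `&` H3 `<=` N -> [\/ H1 `<=` N, H2 `<=` N | H3 `<=` N].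
Proof.
move=> [_ Nirr] sH1 sH2 sH3 /(Nirr _ _ (submoduleI sH1 sH2) sH3).
case=> [/(Nirr _ _ sH1 sH2)[]|] ?; by [constructor 1|constructor 2|constructor 3].
Qed.

End Submodules.

(** * Coordinates of a finite product and the splitting of its submodules *)

Section ProductSubmodules.
Set Implicit Arguments.
Unset Strict Implicit.
Variables (I : finType) (R : I -> comPzRingType) (M : forall i, lmodType (R i)).
Implicit Types (N H : set (prod_module M)) (Ni : forall i, set (M i)).

Definition single (k : I) (y : M k) : prod_module M :=
  [ffun i => dfwith (fun i => 0 : M i) y i].

Lemma single_in k (y : M k) : single y k = y.
Proof. by rewrite ffunE dfwith_in. Qed.

Lemma single_out k (y : M k) i : k != i -> single y i = 0.
Proof. by move=> ki; rewrite ffunE dfwith_out. Qed.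

Lemma single0 k : single (0 : M k) = 0.
Proof.
apply/ffunP => i; rewrite [RHS]ffunE.
by case: (eqVneq k i) => [<-|ki]; rewrite ?single_in ?single_out.
Qed.

Lemma single_linear k (a : prod_ring R) (u v : M k) :
  single (a k *: u + v) = a *: single u + single v.
Proof.
apply/ffunP => i; rewrite [RHS]ffunE [X in _ = X + _]ffunE.
case: (eqVneq k i) => [<-|ki]; first by rewrite !single_in.
by rewrite !single_out // scaler0 addr0.
Qed.

Lemma prod_module_sum (x : prod_module M) : x = \sum_i single (x i).
Proof.
have sumE (F : I -> prod_module M) i : (\sum_j F j) i = \sum_j F j i.
  by elim/big_rec2: _ => [|j y z _ <-]; rewrite ffunE.
apply/ffunP => i; rewrite sumE (bigD1 i) //= single_in big1 ?addr0 // => j ji.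
by rewrite single_out.
Qed.

(** Truncation to one coordinate is multiplication by an idempotent of the product ring, so it
    cannot leave a submodule. *)
Lemma single_idempotent (x : prod_module M) k :
  single (x k) = ([ffun i => (i == k)%:R] : prod_ring R) *: x.
Proof.
apply/ffunP => i; rewrite [RHS]ffunE ffunE.
case: (eqVneq i k) => [->|ik]; first by rewrite dfwith_in ffunE eqxx scale1r.
by rewrite dfwith_out 1?eq_sym // ffunE (negPf ik) scale0r.
Qed.

(** A preimage under the embedding of the factor; for a submodule it agrees with the image under
    projection, without an existential. *)
Definition component N k : set (M k) := [set y | N (single y)].
Arguments component N k _ : clear implicits.

Definition cylinder k (H : set (M k)) : set (prod_module M) :=
  [set x : prod_module M | H (x k)].

Lemma submodule_component N k : submodule N -> submodule (component N k).
Proof.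
move=> sN; apply/submoduleP; split=> [|a u v Nu Nv].
  by rewrite /component /= single0; apply: submodule0.
(* The product is a module over the product ring, so [a] has to be lifted to it; only coordinate [k]
   of the lift matters. *)
pose b : prod_ring R := [ffun i => dfwith (fun i => 0 : R i) a i].
have bk : b k = a by rewrite ffunE dfwith_in.
rewrite /component /= -bk single_linear.
by apply: submoduleD => //; apply: submoduleZ.
Qed.

Lemma component_mem N (x : prod_module M) k :
  submodule N -> N x -> component N k (x k).
Proof.
by move=> sN Nx; rewrite /component /= single_idempotent; apply: submoduleZ.
Qed.

Lemma submodule_prodE N : submodule N -> N = prod_set (component N).
Proof.
move=> sN; apply/seteqP; split=> [x Nx i|x Nx]; first exact: component_mem.
rewrite (prod_module_sum x); elim/big_rec: _ => [|i y _ Ny].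
  exact: submodule0.
by apply: submoduleD => //; apply: Nx.
Qed.

Lemma submodule_prod_set Ni :
  (forall i, submodule (Ni i)) -> submodule (prod_set Ni).
Proof.
move=> sN; apply/submoduleP; split=> [i|a u v Nu Nv i].
  by rewrite ffunE; apply: submodule0.
by rewrite ffunE [X in X + _]ffunE; apply: submoduleD => //; apply: submoduleZ.
Qed.

Lemma submodule_cylinder k (H : set (M k)) :
  submodule H -> submodule (cylinder H).
Proof.
move=> sH; apply/submoduleP; split=> [|a u v Hu Hv]; rewrite /cylinder /=.
  by rewrite ffunE; apply: submodule0.
by rewrite ffunE [X in X + _]ffunE; apply: submoduleD => //; apply: submoduleZ.
Qed.

Lemma component_subset Ni H k : H `<=` prod_set Ni -> component H k `<=` Ni k.
Proof. by move=> HN y /HN/(_ k); rewrite single_in. Qed.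

(** If the constraint at [k] follows from the others, testing it on [single y], whose other
    coordinates are zero, shows that it is vacuous. *)
Lemma prod_set_full Ni k : (forall i, submodule (Ni i)) ->
  (forall x : prod_module M, (forall i, i != k -> Ni i (x i)) -> prod_set Ni x) ->
  Ni k = setT.
Proof.
move=> sN sub; apply/seteqP; split=> // y _.
rewrite -[y]single_in; apply: sub => i ik.
by rewrite single_out 1?eq_sym //; apply: submodule0.
Qed.

Lemma strongly_2_irreducible_proper_components Ni a b c :
  strongly_2_irreducible (prod_set Ni) -> (forall i, submodule (Ni i)) ->
  uniq [:: a; b; c] ->
  [\/ Ni a = setT, Ni b = setT | Ni c = setT].
Proof.
move=> [_ Nirr] sN /=; rewrite !inE negb_or andbT => /andP[/andP[ab ac] bc].
pose drop p q := prod_set (fun i => if i \in [:: p; q] then setT else Ni i).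
have sdrop p q : submodule (drop p q).
  apply: submodule_prod_set => i.
  by case: ifP => _ //; apply: submoduleT.
(* A vector that meets all constraints except the one at [q] lies in both submodules. *)
have dropI p q r : p != r -> drop p q `&` drop q r `<=` prod_set Ni -> Ni q = setT.
  move=> pr sub; apply: prod_set_full => // x xN; apply: sub; split=> i; case: ifPn => // iout;
    by apply: xN; apply: contraNneq iout => ->; rewrite !inE eqxx ?orbT.
(* Each index is still constrained by one of the three: [a] by the first, [b] by the second, [c] by
   the third, any other index by all. *)
have sub : drop b c `&` drop c a `&` drop a b `<=` prod_set Ni.
  move=> x [[x1 x2] x3] i; have := x1 i; have := x2 i; have := x3 i.
  rewrite !inE; case: (eqVneq i a) => [->|ia].
    by rewrite (negPf ab) (negPf ac).
  case: (eqVneq i b) => [->|ib] //=.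
  by rewrite eq_sym in bc; rewrite eq_sym (negPf bc).
have [/dropI h|/dropI h|] := Nirr _ _ _ (sdrop b c) (sdrop c a) (sdrop a b) sub.
- by constructor 3; apply: h; rewrite eq_sym.
- by constructor 1; apply: h; rewrite eq_sym.
- by rewrite setIC => /dropI h; constructor 2; apply: h.
Qed.

(** * Cylinders over a single factor *)

Lemma cylinderE Ni k : (forall i, i != k -> Ni i = setT) ->
  prod_set Ni = cylinder (Ni k).
Proof.
move=> full; apply/seteqP; split=> [x /(_ k)//|x xk i].
by case: (eqVneq i k) => [->|/full->].
Qed.

Lemma cylinder_subset k (H1 H2 : set (M k)) :
  cylinder H1 `<=` cylinder H2 -> H1 `<=` H2.
Proof. by move=> sub y Hy; have := sub (single y); rewrite /cylinder /= single_in; apply. Qed.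

Lemma component_cylinder k (H : set (M k)) : component (cylinder H) k = H.
Proof. by apply/seteqP; split=> y; rewrite /component /cylinder /= single_in. Qed.

Lemma proper_cylinder k (H : set (M k)) :
  proper_submodule (cylinder H) <-> proper_submodule H.
Proof.
split=> -[sH HT]; split.
- by rewrite -(component_cylinder H); apply: submodule_component.
- by move=> HT'; apply: HT; rewrite HT'.
- exact: submodule_cylinder.
- by move=> HT'; apply: HT; rewrite -(component_cylinder H) HT'.
Qed.

(** Test submodules travel both ways: those of [M k] are lifted to cylinders, those of the product
    are replaced by their components at [k]. *)
Lemma cylinder_strongly_2_irreducible k (H : set (M k)) :
  strongly_2_irreducible (cylinder H) <-> strongly_2_irreducible H.
Proof.
split=> -[/proper_cylinder pH Hirr]; split=> //.
  move=> H1 H2 H3 /submodule_cylinder s1 /submodule_cylinder s2.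
  move=> /submodule_cylinder s3 sub.
  have [|h|h|h] := Hirr _ _ _ s1 s2 s3; first by move=> x; apply: sub.
  - by constructor 1; apply: cylinder_subset.
  - by constructor 2; apply: cylinder_subset.
  - by constructor 3; apply: cylinder_subset.
move=> H1 H2 H3 s1 s2 s3 sub.
have lift H4 H5 : submodule H4 -> submodule H5 ->
    component H4 k `&` component H5 k `<=` H -> H4 `&` H5 `<=` cylinder H.
  by move=> s4 s5 sub' x [x4 x5]; apply: sub'; split; apply: component_mem.
have [|h|h|h] := Hirr (component H1 k) (component H2 k) (component H3 k)
  (submodule_component k s1) (submodule_component k s2) (submodule_component k s3).
- by move=> y /sub; rewrite /cylinder /= single_in.
- by constructor 1; apply: lift.
- by constructor 2; apply: lift.
- by constructor 3; apply: lift.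
Qed.

(** * Products constrained at two indices *)

Lemma two_components_strongly_irreducible Ni k m :
  strongly_2_irreducible (prod_set Ni) -> (forall i, submodule (Ni i)) ->
  k != m -> (forall i, i \notin [:: k; m] -> Ni i = setT) ->
  Ni k <> setT -> Ni m <> setT -> strongly_irreducible (Ni k).
Proof.
move=> [_ Nirr] sN km full NkT NmT; split=> // H1 H2 s1 s2 sub.
have sm := submodule_cylinder (sN m).
have lift (H : set (M k)) : submodule H ->
    cylinder H `&` cylinder (Ni m) `<=` prod_set Ni -> H `<=` Ni k.
  move=> sH subH y Hy; rewrite -[y]single_in; apply: subH; split.
    by rewrite /cylinder /= single_in.
  by rewrite /cylinder /= single_out //; apply: submodule0.
have [|h|h|h] := Nirr _ _ _ (submodule_cylinder s1) (submodule_cylinder s2) sm.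
- move=> x [[x1 x2] xm] i; have [|/full->//] := boolP (i \in [:: k; m]).
  by rewrite !inE => /orP[]/eqP-> //; apply: sub.
(* This outcome is impossible: a vector supported at [m] lies in both cylinders over [M k], which
   would force [Ni m] to be full. *)
- case: NmT; apply: prod_set_full => // x xN i; have [->|im] := eqVneq i m; last exact: xN.
  have := h (single (0 : M k) + single (x m)) _ m.
  rewrite single0 add0r single_in; apply.
  by split; rewrite /cylinder /= single_out 1?eq_sym //; apply: submodule0.
- by right; apply: lift.
- by left; apply: lift.
Qed.

(** Strong irreducibility selects one of the three submodules at [k] and one at [m]; the
    intersection of the two selected lies in the product. *)
Lemma prod_set_strongly_2_irreducible Ni k m : proper_submodule (prod_set Ni) ->
  strongly_irreducible (Ni k) -> strongly_irreducible (Ni m) ->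
  (forall i, i \notin [:: k; m] -> Ni i = setT) ->
  strongly_2_irreducible (prod_set Ni).
Proof.
move=> pN irrk irrm full; split=> // H1 H2 H3 s1 s2 s3 sub.
have lift H H' : submodule H -> submodule H' -> component H k `<=` Ni k ->
    component H' m `<=` Ni m -> H `&` H' `<=` prod_set Ni.
  move=> sH sH' subk subm x [xH xH'] i.
  have [|/full->//] := boolP (i \in [:: k; m]).
  by rewrite !inE => /orP[]/eqP->; [apply: subk | apply: subm]; apply: component_mem.
have [] := strongly_irreducible3 irrk (submodule_component k s1)
    (submodule_component k s2) (submodule_component k s3) (component_subset sub);
have [] := strongly_irreducible3 irrm (submodule_component m s1)
    (submodule_component m s2) (submodule_component m s3) (component_subset sub);
move=> subm subk.
all: try by constructor 1; apply: lift.
all: try by constructor 1; rewrite setIC; apply: lift.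
all: try by constructor 2; apply: lift.
all: try by constructor 2; rewrite setIC; apply: lift.
all: try by constructor 3; apply: lift.
all: try by constructor 3; rewrite setIC; apply: lift.
(* In the three remaining cases the same submodule is selected twice, so it lies in the product by
   itself and any pair containing it will do. *)
- by constructor 1 => x [x1 _]; apply: (lift H1 H1).
- by constructor 1 => x [_ x2]; apply: (lift H2 H2).
- by constructor 2 => x [_ x3]; apply: (lift H3 H3).
Qed.

End ProductSubmodules.

Arguments component {I R M} N k _.

Theorem theorem2p26 (n : nat) (hn : (2 <= n)%N)
    (R : 'I_n -> comPzRingType) (M : forall i : 'I_n, lmodType (R i))
    (N : set (prod_module M)) (hN : proper_submodule N) :
  strongly_2_irreducible N <->
  (exists (Ni : forall i : 'I_n, set (M i)) (k : 'I_n),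
      [/\ N = prod_set Ni,
          strongly_2_irreducible (Ni k)
        & forall i : 'I_n, i != k -> Ni i = setT]) \/
  (exists (Ni : forall i : 'I_n, set (M i)) (k m : 'I_n),
      [/\ N = prod_set Ni,
          strongly_irreducible (Ni k),
          strongly_irreducible (Ni m)
        & forall i : 'I_n, i \notin [:: k; m] -> Ni i = setT]).
Proof.
split=> [irr|[[Ni [k [NE irr full]]]|[Ni [k [m [NE irrk irrm full]]]]]]; last 2 first.
- by rewrite NE (cylinderE full); apply/cylinder_strongly_2_irreducible.
- by rewrite NE in hN *; apply: (prod_set_strongly_2_irreducible hN irrk irrm).
have [sN NT] := hN; have NE := submodule_prodE sN.
have sNi i := submodule_component i sN.
have [k kT] : exists k, component N k <> setT.
  apply: contrapT => /forallNP full; apply: NT; rewrite NE.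
  by apply/seteqP; split=> // x _ i; have /contrapT-> := full i.
(* Whether a second proper component exists decides between the two alternatives of the
   statement. *)
have [[m mk mT]|full] := pselect (exists2 m, m != k & component N m <> setT); last first.
  have full' i : i != k -> component N i = setT.
    by move=> ik; apply: contrapT => iT; apply: full; exists i.
  left; exists (component N), k; split=> //.
  by apply/cylinder_strongly_2_irreducible; rewrite -cylinderE // -NE.
have full i : i \notin [:: k; m] -> component N i = setT.
  rewrite !inE negb_or => /andP[ik im].
  have uniq_ikm : uniq [:: i; k; m].
    by rewrite /= !inE negb_or ik im eq_sym mk.
  have irr' : strongly_2_irreducible (prod_set (component N)) by rewrite -NE.
  (* Since the components at [k] and [m] are proper, the one at [i] must be the full one. *)
  by have [] := strongly_2_irreducible_proper_components irr' sNi uniq_ikm.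
right; exists (component N), k, m; split=> //.
- by apply: (two_components_strongly_irreducible (m := m)); rewrite -?NE // eq_sym.
- apply: (two_components_strongly_irreducible (m := k)); rewrite -?NE // => i ikm.
  by apply: full; move: ikm; rewrite !inE orbC.
Qed.
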